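(* Let $e_{mn}=|E(\mathcal T(X,\mathcal P))|$, where $\mathcal P$ is the uniform partition of the set $X=\{1,\dots,m\}\times\{1,\dots,n\}$ into $m$ blocks of size $n$, namely $C_i=\{i\}\times\{1,\dots,n\}$ for $i\in\{1,\dots,m\}$. Then $$e_{0n}=1\quad\text{for all } n,\qquad e_{mn}=\sum_{k=1}^m\binom{m-1}{k-1}\,k\,e_{m-k,n}\sum_{l=1}^n\binom nl\,l^{kn-l}\quad\text{for } m\ge1.$$
   Context: Here $m,n$ are non-negative integers; the cases $m=0$ and $n=0$ are allowed. $\mathcal T(X,\mathcal P)$ is the monoid, under composition, of all functions $f:X\to X$ such that for every $i\in\{1,\dots,m\}$ there is a $j\in\{1,\dots,m\}$ with $C_if\subseteq C_j$ (maps written on the right). If $m=0$ or $n=0$, then $\mathcal T(X,\mathcal P)$ is the one-element monoid consisting of the empty map. $E(M)$ denotes the set of idempotents of a monoid $M$, i.e. the elements $x\in M$ with $x^2=x$.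
   Formalization: The recurrence for m ≥ 1 is stated only for n ≥ 1: at n = 0 it fails, since e_{m0} = 1 (one-element monoid) while the sum over l from 1 to 0 is empty, making the right-hand side 0; e_{0n} = 1 is kept for all n. *)

(* Defs.v *)
From HB Require Import structures.
From mathcomp Require Import all_boot.
Set Implicit Arguments.
Unset Strict Implicit.
Unset Printing Implicit Defensive.

HB.structure Definition FinMonoid := { M of Monoid M & Finite M }.

Definition idempotents (M : FinMonoid.type) : {set M} :=
  [set x : M | (x * x)%g == x].

Section BlockMaps.
Variables (I X : finType) (C : I -> {set X}).

Definition maps_blocks (f : {ffun X -> X}) : bool :=
  [forall i, exists j, f @: C i \subset C j].

(* A record, rather than a bare subset of {ffun X -> X}, so that it can carry
   composition as its product (the library multiplies functions pointwise). *)
Record block_map : Type :=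
  BlockMap { block_fun :> {ffun X -> X}; block_funP : maps_blocks block_fun }.

HB.instance Definition _ := [isSub for block_fun].
HB.instance Definition _ := [Finite of block_map by <:].

Lemma maps_blocks_id : maps_blocks [ffun x => x].
Proof.
apply/forallP=> i; apply/existsP; exists i.
by apply/subsetP=> _ /imsetP[x Cx ->]; rewrite ffunE.
Qed.

Lemma maps_blocks_comp (f g : block_map) : maps_blocks [ffun x => g (f x)].
Proof.
apply/forallP=> i; have /forallP/(_ i)/existsP[j /subsetP fj] := block_funP f.
have /forallP/(_ j)/existsP[k /subsetP gk] := block_funP g.
apply/existsP; exists k; apply/subsetP=> _ /imsetP[x Cx ->].
by rewrite ffunE; apply: gk; apply: imset_f; apply: fj; apply: imset_f.
Qed.

Definition block_one : block_map := BlockMap maps_blocks_id.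

(* Maps act on the right: x(fg) = (xf)g. *)
Definition block_mul (f g : block_map) : block_map :=
  BlockMap (maps_blocks_comp f g).

Lemma block_mulA : associative block_mul.
Proof. by move=> f g h; apply/val_inj/ffunP=> x; rewrite !ffunE. Qed.

Lemma block_mul1 : left_id block_one block_mul.
Proof. by move=> f; apply/val_inj/ffunP=> x; rewrite !ffunE. Qed.

Lemma block_mulr1 : right_id block_one block_mul.
Proof. by move=> f; apply/val_inj/ffunP=> x; rewrite !ffunE. Qed.

HB.instance Definition _ :=
  isMonoid.Build block_map block_mulA block_mul1 block_mulr1.

End BlockMaps.

Definition uniform_block (m n : nat) (i : 'I_m) : {set 'I_m * 'I_n} :=
  setX [set i] [set: 'I_n].

(* If m = 0 or n = 0 then 'I_m * 'I_n is empty, and this is the one-element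
   monoid consisting of the empty map. *)
Definition uniform_monoid (m n : nat) : FinMonoid.type :=
  block_map (@uniform_block m n).

(* e_mn.  For m >= 1 the recurrence needs n >= 1: e_m0 = 1, whereas its
   right-hand side is 0 at n = 0 because the sum over 1 <= l <= n is empty. *)
Definition num_idempotents (m n : nat) : nat :=
  #|idempotents (uniform_monoid m n)|.

(* Main.v *)
(** An idempotent of T(X,P) induces an idempotent of the index set of the
    blocks.  Fix a block x, let r be the block into which x is sent, let K be
    the set of all blocks that are sent into r (so x and r lie in K), and let L
    be the set of fixed points in block r.  The idempotent is then given by an
    arbitrary idempotent on the blocks outside K, together with an arbitrary
    map into L of the |K| n - |L| points over K that are not in L.  Summing over
    K, r and L gives the recurrence. *)
Require Import Defs.
From mathcomp Require Import all_boot.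

Set Implicit Arguments.
Unset Strict Implicit.
Unset Printing Implicit Defensive.

(** * Sums over subsets whose terms depend only on the cardinality *)

Lemma big_subset_card (T : finType) (B : {set T}) (F : nat -> nat) :
  \sum_(A : {set T} | A \subset B) F #|A| =
  \sum_(0 <= k < #|B|.+1) 'C(#|B|, k) * F k.
Proof.
rewrite big_mkord.
(* [inord] never takes its default value here, since a subset of [B] has at most [#|B|] elements. *)
rewrite (partition_big (fun A : {set T} => inord #|A| : 'I_#|B|.+1) predT) //=.
apply: eq_bigr => k _; rewrite -cards_draws -sum_nat_const.
apply: eq_big => [A | A /andP[sAB /eqP <-]].
  rewrite inE; case sAB: (A \subset B) => //=.
  by rewrite -val_eqE /= inordK // ltnS subset_leq_card.
by rewrite inordK // ltnS subset_leq_card.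
Qed.

(** Deleting [x] is a bijection onto the subsets of [B :\ x] that lowers the cardinality by one. *)
Lemma big_subset_mem_card (T : finType) (B : {set T}) (x : T) (F : nat -> nat) :
  x \in B ->
  \sum_(A : {set T} | (A \subset B) && (x \in A)) F #|A| =
  \sum_(1 <= k < #|B|.+1) 'C(#|B| - 1, k - 1) * F k.
Proof.
move=> Bx; rewrite (reindex_onto (fun A => x |: A) (fun A => A :\ x)) /=; last first.
  by move=> A /andP[_ Ax]; rewrite setD1K.
transitivity (\sum_(A : {set T} | A \subset B :\ x) F #|A|.+1).
  apply: eq_big => [A | A].
    rewrite setU11 andbT subUset sub1set Bx /= subsetD1.
    case: (A \subset B) => //=; apply/eqP/idP => [<- | /setU1K //].
    by rewrite !inE eqxx.
  by case/andP=> _ /eqP <-; rewrite cardsU1 !inE eqxx.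
rewrite (big_subset_card _ (fun k => F k.+1)) big_add1 /= (cardsD1 x B) Bx /=.
by apply: eq_bigr => k _; rewrite !subn1.
Qed.

(** * Idempotents supported on a set of blocks, and retractions *)

Section Idempotents.
Variables (I T : finType).
Implicit Types (S K : {set I}) (L : {set T}) (f g h : {ffun I * T -> I * T}).

(** Stands for the idempotents on the blocks in [S], extended by the identity to keep one ambient
    type while [S] shrinks. The last clause is preservation of blocks. *)
Definition block_idempotents_on S : {set {ffun I * T -> I * T}} :=
  [set f : {ffun I * T -> I * T} |
     [forall y, [&& f (f y) == f y,
                    (y.1 \notin S) ==> (f y == y),
                    (y.1 \in S) ==> ((f y).1 \in S)
                  & [forall t, (f (y.1, t)).1 == (f y).1]]]].

Lemma block_idempotents_onP S f :
  reflect [/\ forall y, f (f y) = f y,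
              forall y, y.1 \notin S -> f y = y,
              forall y, y.1 \in S -> (f y).1 \in S
            & forall y z, y.1 = z.1 -> (f y).1 = (f z).1]
          (f \in block_idempotents_on S).
Proof.
rewrite inE; apply: (iffP forallP) => [Hf | [f1 f2 f3 f4] y].
  split=> [y | y | y | [i t] [_ u] /= <-].
  - by have /and4P[/eqP] := Hf y.
  - by have /and4P[_ /implyP H _ _] := Hf y => /H /eqP.
  - by have /and4P[_ _ /implyP] := Hf y.
  - by have /and4P[_ _ _ /forallP/(_ t)/eqP] := Hf (i, u).
apply/and4P; split; first by rewrite f1.
- by apply/implyP=> /f2 ->.
- by apply/implyP=> /f3.
- by apply/forallP=> t; apply/eqP/f4.
Qed.

Lemma card_block_idempotents_on0 : #|block_idempotents_on set0| = 1.
Proof.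
apply/eqP/cards1P; exists [ffun y => y]; apply/setP=> f; rewrite in_set1.
apply/block_idempotents_onP/eqP => [[_ fid _ _] | ->].
  by apply/ffunP=> y; rewrite ffunE fid ?inE.
by split=> [y | y _ | y | y z yz]; rewrite ?inE ?ffunE.
Qed.

Definition glue K h g : {ffun I * T -> I * T} :=
  [ffun y => if y.1 \in K then h y else g y].

(** Giving each point its set of allowed values makes this a [family], counted by a product. *)
Definition retractions K r L : {set {ffun I * T -> I * T}} :=
  [set h : {ffun I * T -> I * T} |
     [forall y, h y \in if y \in setX K setT :\: setX [set r] L
                        then setX [set r] L else [set y]]].

Lemma card_retractions K r L :
  r \in K -> #|retractions K r L| = #|L| ^ (#|K| * #|T| - #|L|).
Proof.
move=> Kr; pose D := setX K [set: T] :\: setX [set r] L.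
pose F y := mem (if y \in D then setX [set r] L else [set y]).
transitivity #|(family F : pred {ffun I * T -> I * T})|.
  by apply: eq_card => h; rewrite inE; apply: eq_forallb.
rewrite card_family.
(* Points outside [D] have one allowed value, points of [D] have [#|L|]. *)
rewrite foldrE big_image /= (bigID (mem D)) /= [X in _ * X]big1 ?muln1; last first.
  by move=> y /negPf Dy; rewrite /F Dy -[RHS](cards1 y); apply: eq_card.
rewrite (eq_bigr (fun=> #|L|)) => [|y Dy]; last first.
  by rewrite /F Dy -[RHS]mul1n -(cards1 r) -cardsX; apply: eq_card.
rewrite prod_nat_const /D cardsD (setIidPr _) ?cardsX ?cards1 ?cardsT ?mul1n //.
by apply/subsetP=> -[i t]; rewrite !inE /= andbT => /andP[/eqP-> _].
Qed.

Lemma retractionsP K r L h :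
  r \in K -> reflect [/\ forall y, y.1 \notin K -> h y = y,
                         forall t, t \in L -> h (r, t) = (r, t)
                       & forall y, y.1 \in K -> (h y).1 = r /\ (h y).2 \in L]
          (h \in retractions K r L).
Proof.
move=> Kr; rewrite inE; apply: (iffP forallP) => [Hh | [h1 h2 h3] y].
  split=> [y /negPf Ky | t Lt | [i t] /= Ki].
  - by have:= Hh y; rewrite !inE Ky andbF inE => /eqP.
  - by have:= Hh (r, t); rewrite !inE /= eqxx Lt /= inE => /eqP.
  have:= Hh (i, t); rewrite !inE /= Ki !andbT; case: ifP => [_|].
    by rewrite !inE => /andP[/eqP].
  by move=> /negbT; rewrite negbK => /andP[/eqP-> Lt]; rewrite inE => /eqP->.
case: ifP => Dy; rewrite !inE.
  by move: Dy; rewrite !inE andbT => /andP[_ /h3[-> ->]]; rewrite eqxx.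
move: Dy; case: y => i t; rewrite !inE /= andbT.
case Ki: (i \in K); last by rewrite h1 /= ?Ki.
by rewrite andbT => /negbT; rewrite negbK => /andP[/eqP-> /h2 ->].
Qed.

(** * Decomposition along the block [x] *)

Variables (S : {set I}) (x : I) (t0 : T).
Hypothesis Sx : x \in S.

(** This and the next two definitions are r, K and L of the overview. The choice of [t0] is
    immaterial when [f] preserves blocks. *)
Definition head_image f : I := (f (x, t0)).1.
Definition head_fibre f : {set I} := [set i | (f (i, t0)).1 == head_image f].
Definition head_fixed f : {set T} :=
  [set t | f (head_image f, t) == (head_image f, t)].

(** Blocks outside [S] are fixed, while r lies in [S] because [x] does; idempotence puts r in its
    own fibre. *)
Lemma head_fibreP f : f \in block_idempotents_on S ->
  [/\ head_fibre f \subset S, x \in head_fibre f & head_image f \in head_fibre f].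
Proof.
case/block_idempotents_onP=> f1 f2 f3 f4; split.
- apply/subsetP=> i; rewrite inE; apply: contraLR => Si.
  by rewrite f2 //; apply: contraNneq Si => /= ->; apply: f3.
- by rewrite inE.
- by rewrite inE; apply/eqP; rewrite (f4 _ (f (x, t0))) // f1.
Qed.

Lemma glue_head K r L g h : K \subset S -> x \in K -> r \in K ->
  g \in block_idempotents_on (S :\: K) -> h \in retractions K r L ->
  [/\ glue K h g \in block_idempotents_on S, head_fibre (glue K h g) = K,
      head_image (glue K h g) = r & head_fixed (glue K h g) = L].
Proof.
move=> sKS Kx Kr /block_idempotents_onP[g1 g2 g3 g4].
move=> /(retractionsP L h Kr)[h1 h2 h3].
(* Since [g] never enters [K] from outside and [h] keeps [K] inside [K], the two pieces do not
   interact under composition. *)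
have gK y : y.1 \notin K -> (g y).1 \notin K.
  move=> Ky; case Sy: (y.1 \in S); last by rewrite g2 // inE Sy andbF.
  by have:= g3 y; rewrite !inE Ky Sy => /(_ isT)/andP[].
have im : head_image (glue K h g) = r by rewrite /head_image ffunE Kx; case: (h3 (x, t0)).
split=> //.
- apply/block_idempotents_onP; split=> [y | y Sy | y Sy | y z yz].
  + rewrite [glue K h g y]ffunE; case: ifPn => Ky; last first.
      by rewrite ffunE (negPf (gK _ _)).
    have [] := h3 y Ky; case: (h y) => _ t /= -> Lt.
    by rewrite ffunE /= Kr h2.
  + have Ky: y.1 \notin K by apply: contra Sy; apply: (subsetP sKS).
    by rewrite ffunE (negPf Ky) g2 // inE (negPf Sy) andbF.
  + rewrite ffunE; case: ifPn => Ky.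
      by have [-> _] := h3 y Ky; apply: (subsetP sKS).
    by have:= g3 y; rewrite !inE Ky Sy => /(_ isT)/andP[].
  + rewrite !ffunE yz; case: ifPn => Kz; last exact: g4.
    by have [-> _] := h3 z Kz; have [|-> //] := h3 y; rewrite yz.
- apply/setP=> i; rewrite inE im ffunE /=; case: ifPn => Ki.
    by have [-> _] := h3 (i, t0) Ki; rewrite eqxx.
  by apply: contraNF (gK (i, t0) Ki) => /eqP->.
- apply/setP=> t; rewrite inE im ffunE /= Kr.
  apply/eqP/idP => [eht | /h2 //].
  by have [_] := h3 (r, t) Kr; rewrite eht.
Qed.

(** The pieces are [f] off [K] and [f] on [K], each completed by the identity. *)
Lemma head_glue f : f \in block_idempotents_on S ->
  let K := head_fibre f in
  exists2 p, p \in setX (block_idempotents_on (S :\: K))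
                        (retractions K (head_image f) (head_fixed f))
           & f = glue K p.2 p.1.
Proof.
move=> fS K; have [sKS Kx Kr] := head_fibreP fS.
case/block_idempotents_onP: fS => f1 f2 f3 f4.
have imK y : (y.1 \in K) = ((f y).1 == head_image f).
  by rewrite inE (f4 _ y).
have ffK y : ((f y).1 \in K) = (y.1 \in K) by rewrite !imK f1.
pose g : {ffun I * T -> I * T} := [ffun y => if y.1 \in K then y else f y].
pose h : {ffun I * T -> I * T} := [ffun y => if y.1 \in K then f y else y].
exists (g, h); last by apply/ffunP=> y; rewrite ffunE /= !ffunE; case: ifP => ->.
rewrite in_setX /=; apply/andP; split.
  apply/block_idempotents_onP; split=> [y | y | y | y z yz].
  - by rewrite !ffunE; case Ky: (y.1 \in K); rewrite ?ffK Ky.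
  - rewrite inE negb_and negbK ffunE; case: ifP => //= _; exact: f2.
  - rewrite !in_setD ffunE => /andP[Ky Sy].
    by rewrite (negPf Ky) f3 // andbT; move: Ky; rewrite -ffK.
  - by rewrite !ffunE yz; case: ifP => // _; apply: f4.
apply/(retractionsP _ _ Kr); split=> [y Ky | t | y Ky].
- by rewrite ffunE (negPf Ky).
- by rewrite inE ffunE /= Kr => /eqP.
(* The point [f y] lies in block r and is fixed by [f], so its second coordinate is in L. *)
- rewrite ffunE Ky inE; move: (Ky); rewrite imK => /eqP Er; split=> //.
  by rewrite -Er -surjective_pairing f1.
Qed.

(** Gluing is injective on these pairs because [g] is the identity on [K] and [h] is the identity
    off [K]. *)
Lemma card_head_fibre K r L : K \subset S -> x \in K -> r \in K ->
  #|[set f in block_idempotents_on S |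
       [&& head_fibre f == K, head_image f == r & head_fixed f == L]]| =
  #|block_idempotents_on (S :\: K)| * #|L| ^ (#|K| * #|T| - #|L|).
Proof.
move=> sKS Kx Kr; rewrite -(card_retractions L Kr) -cardsX.
rewrite -(card_in_imset (f := fun p => glue K p.2 p.1)) /=; last first.
  move=> [g h] [g' h']; rewrite !in_setX /=.
  move=> /andP[/block_idempotents_onP[_ g2 _ _] /(retractionsP _ _ Kr)[h2 _ _]].
  move=> /andP[/block_idempotents_onP[_ g2' _ _] /(retractionsP _ _ Kr)[h2' _ _]].
  move=> /ffunP eq_gh; congr pair; apply/ffunP=> y; have:= eq_gh y; rewrite !ffunE.
    by case: ifP => // Ky _; rewrite g2 ?g2' // inE Ky.
  by case: ifPn => // Ky _; rewrite h2 ?h2'.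
apply: eq_card => f; rewrite [LHS]inE; apply/idP/imsetP.
  case/and4P=> fS /eqP<- /eqP<- /eqP<-.
  exact: head_glue.
case=> -[g h]; rewrite in_setX /= => /andP[gS hK ->].
by have [-> -> -> ->] := glue_head sKS Kx Kr gS hK; rewrite !eqxx.
Qed.

Lemma card_block_idempotents_on :
  #|block_idempotents_on S| =
  \sum_(K : {set I} | (K \subset S) && (x \in K))
    #|K| * #|block_idempotents_on (S :\: K)| *
    \sum_(1 <= l < #|T|.+1) 'C(#|T|, l) * l ^ (#|K| * #|T| - l).
Proof.
rewrite -sum1_card.
rewrite (partition_big head_fibre (fun K => (K \subset S) && (x \in K))) /=; last first.
  by move=> f /head_fibreP[-> ->].
apply: eq_bigr => K /andP[sKS Kx].
rewrite (partition_big head_image (mem K)) /=; last first.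
  by move=> f /andP[/head_fibreP[_ _] + /eqP<-].
rewrite -mulnA -sum_nat_const; apply: eq_bigr => r Kr.
rewrite (partition_big head_fixed predT) //=.
have:= big_subset_card [set: T] (fun l => l ^ (#|K| * #|T| - l)).
(* The term l = 0 vanishes: its exponent is positive, as [x] is in [K] and [t0] is in [T]. *)
rewrite cardsT big_ltn // exp0n ?muln0 ?add0n => [<- |]; last first.
  rewrite subn0 muln_gt0.
  by apply/andP; split; apply/card_gt0P; [exists x | exists t0].
rewrite big_distrr /=; apply: eq_big => [L | L _]; first by rewrite subsetT.
rewrite -(card_head_fibre L sKS Kx Kr) -sum1_card; apply: eq_bigl => f.
by rewrite [RHS]inE -!andbA.
Qed.

End Idempotents.

(** * Return to the monoid, and the recurrence *)

Lemma num_idempotentsE m n (t0 : 'I_n) :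
  num_idempotents m n = #|block_idempotents_on 'I_n [set: 'I_m]|.
Proof.
rewrite /num_idempotents -(card_imset _ val_inj); apply: eq_card => f.
apply/imsetP/block_idempotents_onP => [[/= u uu ->] | [f1 _ _ f4]].
  rewrite inE in uu; have ff := congr1 (fun v : block_map _ => val v) (eqP uu).
  split=> [y | y | y | y z yz]; rewrite ?inE //.
    by have /ffunP/(_ y) := ff; rewrite ffunE.
  have /forallP/(_ y.1)/existsP[j /subsetP uj] := block_funP u.
  have u_j w : w.1 = y.1 -> (val u w).1 = j.
    move=> wy; have:= uj (val u w); rewrite !inE andbT => uwj; apply/eqP/uwj.
    by apply: imset_f; rewrite !inE wy eqxx.
  by rewrite !u_j.
have fP : maps_blocks (@uniform_block m n) f.
  (* The image of one point of block [i] already determines the target block. *)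
  apply/forallP=> i; apply/existsP; exists (f (i, t0)).1.
  apply/subsetP=> _ /imsetP[y + ->]; rewrite !inE !andbT => /eqP yi.
  by apply/eqP/f4.
exists (BlockMap fP) => //; rewrite inE; apply/eqP/val_inj/ffunP=> y.
by rewrite ffunE /= f1.
Qed.

Lemma num_idempotents0 n : num_idempotents 0 n = 1.
Proof.
rewrite /num_idempotents -(cards1 (1%g : uniform_monoid 0 n)).
apply: eq_card => f; rewrite !inE.
have fE (g h : uniform_monoid 0 n) : g = h by apply/val_inj/ffunP=> -[[]].
by rewrite (fE (f * f)%g f) (fE f 1%g) !eqxx.
Qed.

(** The induction hypothesis is a premise so that the step can be used for different index types; it
    is applied to [S :\: K], smaller than [S] as [x] is in [K]. *)
Lemma block_idempotents_on_rec (I : finType) n (S : {set I}) :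
  0 < n -> 0 < #|S| ->
  (forall K : {set I}, #|K| < #|S| ->
     #|block_idempotents_on 'I_n K| = num_idempotents #|K| n) ->
  #|block_idempotents_on 'I_n S| =
       \sum_(1 <= k < #|S|.+1)
         'C(#|S| - 1, k - 1) * k * num_idempotents (#|S| - k) n *
         (\sum_(1 <= l < n.+1) 'C(n, l) * l ^ (k * n - l)).
Proof.
move=> n_gt0 /card_gt0P[x Sx] IH.
rewrite (card_block_idempotents_on (Ordinal n_gt0) Sx) card_ord.
pose F k := k * num_idempotents (#|S| - k) n *
            (\sum_(1 <= l < n.+1) 'C(n, l) * l ^ (k * n - l)).
transitivity (\sum_(K : {set I} | (K \subset S) && (x \in K)) F #|K|).
  apply: eq_bigr => K /andP[sKS Kx].
  have cSK : #|S :\: K| = #|S| - #|K| by rewrite cardsD (setIidPr sKS).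
  rewrite IH cSK // ltn_subrL; apply/andP.
  by split; apply/card_gt0P; exists x.
by rewrite (big_subset_mem_card F Sx); apply: eq_bigr => k _; rewrite /F !mulnA.
Qed.

(** No bijection between [S] and an ordinal is built: both sides satisfy the same recurrence. *)
Lemma card_block_idempotents_onE (I : finType) n (S : {set I}) :
  0 < n -> #|block_idempotents_on 'I_n S| = num_idempotents #|S| n.
Proof.
(* The type [I] is generalised because the hypothesis is needed for subsets of [I] and of
   ['I_#|S|]. *)
move=> n_gt0; have [s] := ubnP #|S|; elim: s I S => // s IHs I S.
rewrite ltnS => leSs; have [S0 | S_gt0] := posnP #|S|.
  by rewrite S0 (cards0_eq S0) card_block_idempotents_on0 num_idempotents0.
rewrite block_idempotents_on_rec // => [|K ltKS]; last first.
  by apply: IHs; apply: leq_trans ltKS leSs.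
have cS : #|[set: 'I_#|S|]| = #|S| by rewrite cardsT card_ord.
rewrite (num_idempotentsE _ (Ordinal n_gt0)) block_idempotents_on_rec ?cS // => K ltKS.
by apply: IHs; apply: leq_trans ltKS leSs.
Qed.

Theorem proposition3p2 :
  (forall n : nat, num_idempotents 0 n = 1) /\
  (forall m n : nat, 1 <= m -> 1 <= n ->
     num_idempotents m n =
       \sum_(1 <= k < m.+1)
         'C(m - 1, k - 1) * k * num_idempotents (m - k) n *
         (\sum_(1 <= l < n.+1) 'C(n, l) * l ^ (k * n - l))).
Proof.
split=> [|m n m_gt0 n_gt0]; first exact: num_idempotents0.
have cT : #|[set: 'I_m]| = m by rewrite cardsT card_ord.
rewrite (num_idempotentsE _ (Ordinal n_gt0)) block_idempotents_on_rec ?cT // => K _.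
exact: card_block_idempotents_onE.
Qed.
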